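(* Assume that for every non-constant natural function $g\in\mathcal{F}_{Natural}$ one has $g(\mathbb{I})\not\subset\mathbb{P}$. Then there are infinitely many composite Fermat numbers, i.e. infinitely many composite numbers of the form $2^{2^n}+1$ with $n\in\mathbb{I}$.
   Context: Let $\mathbb{I}=\{1,2,3,\ldots\}$ be the set of non-zero positive integers, $\mathbb{P}$ the set of prime numbers, and $\mathcal{F}$ the set of all functions from $\mathbb{I}$ to $\mathbb{I}$. For $f,g\in\mathcal{F}$, the functions $f+g$, $f\times g$, $f\wedge g$ are defined pointwise, where $\wedge$ is exponentiation: $(f\wedge g)(n)=f(n)^{g(n)}$. Let $\mathcal{F}_s\subset\mathcal{F}$ be the set consisting of the identity map $n\mapsto n$ and all constant maps $n\mapsto a$ with $a\in\mathbb{I}$. For a subset $P\subset\mathcal{F}$ and an operation $*\in\{+,\times,\wedge\}$ put $A_*(P)=P\cup\{f\in\mathcal{F}\mid \exists g\in P,\ \exists h\in P,\ f=g*h\}$. Let $\Sigma$ be the set of all finite words in the letters $A_+,A_\times,A_\wedge$ (each word acting on subsets of $\mathcal{F}$ by composition). The set of natural functions is $\mathcal{F}_{Natural}=\bigcup_{\sigma\in\Sigma}\sigma(\mathcal{F}_s)$. *)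

(* Defs.v *)
From mathcomp Require Import all_boot.
From mathcomp Require Import boolp classical_sets functions cardinality.

Set Implicit Arguments.
Unset Strict Implicit.
Unset Printing Implicit Defensive.

Local Open Scope classical_set_scope.

Definition posint : Type := {n : nat | 0 < n}.

Lemma posint_add_gt0 (a b : posint) : 0 < val a + val b.
Proof. by rewrite addn_gt0 (valP a). Qed.

Lemma posint_mul_gt0 (a b : posint) : 0 < val a * val b.
Proof. by rewrite muln_gt0 (valP a) (valP b). Qed.

Lemma posint_exp_gt0 (a b : posint) : 0 < val a ^ val b.
Proof. by rewrite expn_gt0 (valP a). Qed.

Definition posint_add (a b : posint) : posint := Sub _ (posint_add_gt0 a b).
Definition posint_mul (a b : posint) : posint := Sub _ (posint_mul_gt0 a b).
Definition posint_exp (a b : posint) : posint := Sub _ (posint_exp_gt0 a b).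

Definition prime_set : set posint := [set p | prime (val p)].

Definition composite (m : nat) : bool := (1 < m) && ~~ prime m.

Definition constant_fun (f : posint -> posint) : Prop :=
  exists a : posint, forall n : posint, f n = a.

Inductive operation : Type := OpAdd | OpMul | OpExp.

Definition op_posint (o : operation) : posint -> posint -> posint :=
  match o with
  | OpAdd => posint_add
  | OpMul => posint_mul
  | OpExp => posint_exp
  end.

Definition op_fun (o : operation) (g h : posint -> posint) : posint -> posint :=
  fun n => op_posint o (g n) (h n).

Definition simple_funs : set (posint -> posint) :=
  [set f | f = (fun n => n) \/ exists a : posint, f = (fun=> a)].

Definition adjoin (o : operation) (P : set (posint -> posint)) :
    set (posint -> posint) :=
  P `|` [set f | exists2 g, P g & exists2 h, P h & f = op_fun o g h].

(* The letter [o] of a word stands for the operator [adjoin o]; the word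
   [:: o1; ...; ok] acts as the composite adjoin o1 \o ... \o adjoin ok. *)
Definition word_act (w : seq operation) (P : set (posint -> posint)) :
    set (posint -> posint) :=
  foldr adjoin P w.

Definition natural_funs : set (posint -> posint) :=
  \bigcup_(w in [set: seq operation]) word_act w simple_funs.

(* Main.v *)
Require Import Defs.
From mathcomp Require Import all_boot.
From mathcomp Require Import boolp classical_sets functions cardinality.

(** If only finitely many Fermat numbers were composite, then for [N] large
    enough the natural function [n |-> 2 ^ (2 ^ (n + N)) + 1] would be
    non-constant and take only prime values. *)

Local Open Scope classical_set_scope.

(** Suppose every composite Fermat number is at most [N]. A Fermat number of index beyond [N]
    exceeds [N], hence is prime, so shifting the index gives a non-constant natural function with
    only prime values, against the hypothesis. Naturality follows from closure of [natural_funs]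
    under the three operations ([natural_op]). *)

Lemma adjoin_mono (o : operation) (P Q : set (posint -> posint)) :
  P `<=` Q -> adjoin o P `<=` adjoin o Q.
Proof.
move=> PQ f [Pf|[g Pg [h Ph ->]]]; first by left; apply: PQ.
by right; exists g; [exact: PQ | exists h; [exact: PQ | ]].
Qed.

Lemma word_act_mono (w : seq operation) (P Q : set (posint -> posint)) :
  P `<=` Q -> word_act w P `<=` word_act w Q.
Proof. by move=> PQ; elim: w => //= o w; apply: adjoin_mono. Qed.

Lemma sub_word_act (w : seq operation) (P : set (posint -> posint)) :
  P `<=` word_act w P.
Proof. by elim: w => //= o w IHw f /IHw; left. Qed.

Lemma simple_natural (f : posint -> posint) : simple_funs f -> natural_funs f.
Proof. by exists [::]. Qed.

(** Two functions built by different words [v] and [w] must be brought into one set before [o] can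
    combine them. The word [v ++ w] serves both: [w] only enlarges the set on which [v] acts, and
    [v] only enlarges what [w] produced. *)
Lemma natural_op (o : operation) (g h : posint -> posint) :
  natural_funs g -> natural_funs h -> natural_funs (op_fun o g h).
Proof.
move=> [v _ vg] [w _ wh]; exists (o :: v ++ w) => //=.
rewrite /word_act foldr_cat; right; exists g.
  by apply: (word_act_mono v _ _ (sub_word_act w simple_funs)) vg.
by exists h => //; apply: sub_word_act.
Qed.

Definition shifted_fermat (one two N : posint) : posint -> posint :=
  op_fun OpAdd (op_fun OpExp (fun=> two)
    (op_fun OpExp (fun=> two) (op_fun OpAdd (fun n => n) (fun=> N))))
    (fun=> one).

Lemma natural_shifted_fermat (one two N : posint) :
  natural_funs (shifted_fermat one two N).
Proof.
have natC a : natural_funs (fun=> a) by apply: simple_natural; right; exists a.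
by do !apply: natural_op => //; apply: simple_natural; left.
Qed.

Lemma finite_set_nat_bounded (A : set nat) :
  finite_set A -> exists N, forall m, A m -> m <= N.
Proof.
move=> /finite_seqP[s ->]; exists (\max_(i <- s) i) => m ms.
exact: (leq_bigmax_seq (F := id) m ms).
Qed.

Theorem corollary3p2
  (no_prime_valued : forall g : posint -> posint,
     natural_funs g -> ~ constant_fun g -> ~ (range g `<=` prime_set)) :
  infinite_set [set m : nat | composite m /\
                  exists n : posint, m = 2 ^ (2 ^ val n) + 1].
Proof.
move=> /finite_set_nat_bounded[N leN].
pose one : posint := Sub 1 (ltn0Sn 0); pose two : posint := Sub 2 (ltn0Sn 1).
(* The successor keeps the shift positive even when [N] is 0. *)
pose M : posint := Sub N.+1 (ltn0Sn N).
apply: (no_prime_valued _ (natural_shifted_fermat one two M)).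
  (* Equal values at 1 and 2 would give 1 = 2, by cancelling the sums and the powers of 2. *)
  move=> [a fa]; have := etrans (fa one) (esym (fa two)).
  by move=> /(congr1 val)/= /addIn/expnI-/(_ isT)/expnI-/(_ isT)/addIn.
move=> _ [n _ <-]; rewrite /prime_set /=; apply/negPn/negP => nprime.
(* With k = n + N + 1 > N, this is k < 2^k < 2^(2^k). *)
have gtN : N < 2 ^ (2 ^ (val n + N.+1)).
  apply: (@leq_trans (val n + N.+1)); first exact: leq_addl.
  by apply/ltnW/(ltn_trans (ltn_expl _ _))/ltn_expl.
have : 2 ^ (2 ^ (val n + N.+1)) + 1 <= N.
  apply: leN; split; last by exists (posint_add n M).
  by rewrite /composite nprime addn1 ltnS expn_gt0.
by rewrite leqNgt addn1 ltnS ltnW.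
Qed.
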